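(* Let $R$ be an associative unital ring, let $\kappa\geq \operatorname{card}(R)+\aleph_0$ be a cardinal, let $\mathcal{D}$ be a $\kappa^+$-deconstructible class of right $R$-modules, and let $\mathcal{M}$ be either the class of all embeddings, the class of all RD-embeddings, or the class of all pure embeddings of right $R$-modules. If $\lambda$ is an infinite cardinal with $\lambda^{\kappa}=\lambda$, then $\mathbf{D}=(\mathcal{D},\leq_{\mathcal{M}})$ is stable in $\lambda$.
   Context: Modules are right $R$-modules; $\|M\|$ denotes the cardinality of a module $M$. For an infinite cardinal $\mu$, a module is $<\mu$-presented if it has a presentation with fewer than $\mu$ generators and fewer than $\mu$ relations. For a class $\mathcal{C}$ of modules, a module $M$ is $\mathcal{C}$-filtered if there are an ordinal $\delta$ and an increasing chain of submodules $(M_i\mid i\leq\delta)$ of $M$ with $M_0=0$, $M_\delta=M$, $M_i=\bigcup_{j<i}M_j$ for limit $i\leq\delta$, and $M_{i+1}/M_i$ isomorphic to a member of $\mathcal{C}$ for all $i<\delta$. A class $\mathcal{D}$ is $\mu$-deconstructible if $\mathcal{D}$ is exactly the class of all $\mathcal{D}^{<\mu}$-filtered modules, where $\mathcal{D}^{<\mu}$ is the class of all $<\mu$-presented modules in $\mathcal{D}$. An embedding is a monomorphism. A submodule $N$ of $M$ is an RD-submodule if $N\cap Mr=Nr$ for all $r\in R$; it is a pure submodule if every finite system of $R$-linear equations with right-hand side in $N$ that is solvable in $M$ is solvable in $N$. An RD-embedding (pure embedding) is a monomorphism whose image is an RD-submodule (pure submodule) of its codomain. For $A,B\in\mathcal{D}$,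 $A\leq_{\mathcal{M}}B$ means that $A$ is a submodule of $B$ and the inclusion $A\to B$ is in $\mathcal{M}$. A $\mathbf{D}$-embedding is a monomorphism $f:A\to B$ with $A,B\in\mathcal{D}$ and $f(A)\leq_{\mathcal{M}}B$. Galois types: consider triples $(\bar b,A,N)$ with $N\in\mathcal{D}$, $A$ a submodule of $N$, and $\bar b$ a (possibly infinite) tuple of elements of $N$. Two triples $(\bar b_1,A_1,N_1),(\bar b_2,A_2,N_2)$ are atomically related if $A_1=A_2=:A$ and there are $N\in\mathcal{D}$ and $\mathbf{D}$-embeddings $f_i:N_i\to N$ ($i=1,2$) that restrict to the identity on $A$ and satisfy $f_1(\bar b_1)=f_2(\bar b_2)$. Let $E^{\mathbf{D}}$ be the transitive closure of this relation; $\mathbf{gtp}_{\mathbf{D}}(\bar b/A;N)$ is the $E^{\mathbf{D}}$-class of $(\bar b,A,N)$. For $M\in\mathcal{D}$, $\mathbf{gS}_{\mathbf{D}}(M)=\{\mathbf{gtp}_{\mathbf{D}}(b/M;N)\mid M\leq_{\mathcal{M}}N\in\mathcal{D},\ b\in N \text{ a single element}\}$. $\mathbf{D}$ is stable in $\lambda$ if $|\mathbf{gS}_{\mathbf{D}}(M)|\leq\lambda$ for every $M\in\mathcal{D}$ with $\|M\|=\lambda$. *)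

(* Defs.v *)
From HB Require Import structures.
From mathcomp Require Import all_boot all_algebra.
From mathcomp Require Import all_classical wochoice.
From Stdlib Require Import Relation_Operators.

Set Implicit Arguments.
Unset Strict Implicit.
Unset Printing Implicit Defensive.

Import GRing.Theory.

Local Open Scope classical_set_scope.
Local Open Scope card_scope.
Local Open Scope quotient_scope.
Local Open Scope ring_scope.

(* Right R-modules are left modules over the converse ring [R^c]: for
   [m : rmodType R], the product m r is [r *: m]. *)
Notation rmodType R := (lmodType (GRing.converse R)).

Section Modules.
Variable S : pzRingType.
Implicit Types V W : lmodType S.

Record submodule_type V (A : submodClosed V) := SubmoduleElt {
  submodule_val : V;
  _ : submodule_val \in A }.

HB.instance Definition _ V (A : submodClosed V) :=
  [isSub for @submodule_val V A].
HB.instance Definition _ V (A : submodClosed V) :=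
  [Choice of submodule_type A by <:].
HB.instance Definition _ V (A : submodClosed V) :=
  GRing.SubChoice_isSubLmodule.Build S V (fun x => x \in A)
    (submodule_type A) (submodClosedP A).

Definition submod_incl V (A : submodClosed V) : {linear submodule_type A -> V} :=
  \val.

Definition image_pred V W (f : {linear V -> W}) : {pred W} :=
  fun y => y \in range f.

Lemma image_submod_closed V W (f : {linear V -> W}) :
  submod_closed (image_pred f).
Proof.
split; first by apply/mem_set; exists 0 => //; rewrite linear0.
move=> a _ _ /set_mem[x _ <-] /set_mem[y _ <-].
by apply/mem_set; exists (a *: x + y) => //; rewrite linearP.
Qed.

HB.instance Definition _ V W (f : {linear V -> W}) :=
  GRing.isSubmodClosed.Build S W (image_pred f) (image_submod_closed f).

Definition linear_image V W (f : {linear V -> W}) : submodClosed W :=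
  image_pred f.

(* A /\ B as a submodule of B; used with A included in B, to form B / A. *)
Definition restrict_pred V (A B : submodClosed V) : {pred submodule_type B} :=
  fun x => val x \in A.

Lemma restrict_submod_closed V (A B : submodClosed V) :
  submod_closed (restrict_pred A (B := B)).
Proof.
split=> [|a x y xA yA]; first by rewrite unfold_in raddf0 rpred0.
by rewrite unfold_in linearP rpredD // rpredZ.
Qed.

HB.instance Definition _ V (A B : submodClosed V) :=
  GRing.isSubmodClosed.Build S (submodule_type B) (restrict_pred A (B := B))
    (restrict_submod_closed A B).

Definition restrict_submod V (A B : submodClosed V) :
    submodClosed (submodule_type B) :=
  restrict_pred A (B := B).

(* [submodClosed] is declared over semirings and does not inherit from
   [zmodClosed]. *)
Definition zmod_pred V (A : submodClosed V) : {pred V} := A.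

HB.instance Definition _ V (A : submodClosed V) :=
  GRing.isZmodClosed.Build V (@zmod_pred V A)
    (GRing.submod_closedB (submodClosedP A)).

Definition quotient_type V (A : submodClosed V) : Type :=
  Quotient.quot (@zmod_pred V A).

HB.instance Definition _ V (A : submodClosed V) :=
  GRing.Zmodule.on (quotient_type A).
HB.instance Definition _ V (A : submodClosed V) :=
  EqQuotient.on (quotient_type A).

Section QuotientScale.
Variables (V : lmodType S) (A : submodClosed V).
Local Notation Q := (quotient_type A).

Definition quotient_scale (a : S) (q : Q) : Q := \pi_Q (a *: repr q).

Let eq_piE (x y : V) : (\pi_Q x == \pi_Q y) = (x - y \in A).
Proof. by rewrite [RHS](Quotient.idealrBE (@zmod_pred V A)). Qed.

Let pi_scale (a : S) (x : V) : quotient_scale a (\pi_Q x) = \pi_Q (a *: x).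
Proof.
apply/eqP; rewrite eq_piE -scalerBr rpredZ // -eq_piE; apply/eqP.
exact: reprK.
Qed.

Let piD (x y : V) : \pi_Q (x + y) = \pi_Q x + \pi_Q y.
Proof. exact: (raddfD (\pi_(Quotient.quot (@zmod_pred V A)))). Qed.

Let scaleA a b q :
  quotient_scale a (quotient_scale b q) = quotient_scale (a * b) q.
Proof. by elim/quotW: q => x; rewrite (pi_scale b) !pi_scale scalerA. Qed.

Let scale1 : left_id 1 quotient_scale.
Proof. by elim/quotW=> x; rewrite pi_scale scale1r. Qed.

Let scaleDr : right_distributive quotient_scale +%R.
Proof.
move=> a; elim/quotW=> x; elim/quotW=> y.
by rewrite -piD !pi_scale scalerDr piD.
Qed.

Let scaleDl q : {morph quotient_scale^~ q : a b / a + b}.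
Proof. by elim/quotW: q => x a b; rewrite !pi_scale scalerDl piD. Qed.

HB.instance Definition _ :=
  GRing.Zmodule_isLmodule.Build S Q scaleA scale1 scaleDr scaleDl.
End QuotientScale.

Definition isomorphic V W := exists f : {linear V -> W}, bijective f.

Definition generated V (X : set V) : set V :=
  [set x | forall A : submodClosed V, (forall y, X y -> y \in A) -> x \in A].

Definition is_basis V (B : set V) : Prop :=
  generated B = setT /\
  forall (s : seq V) (c : V -> S),
    uniq s -> (forall x, x \in s -> B x) ->
    \sum_(x <- s) c x *: x = 0 -> forall x, x \in s -> c x = 0.

End Modules.

(* A cardinal is given by a type of that cardinality. *)
Definition card_lt T U (A : set T) (B : set U) : Prop := A #<= B /\ ~ (B #<= A).

Definition infinite_card (T : Type) : Prop := infinite_set [set: T].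

Definition is_succ_card (K Kp : Type) : Prop :=
  card_lt [set: K] [set: Kp] /\
  forall A : set Kp, card_lt A [set: Kp] -> A #<= [set: K].

Section Deconstructible.
Variable R : pzRingType.
Implicit Types (M : rmodType R) (C D : rmodType R -> Prop).

(* M is F / <Y> with F free on B, |B| < mu and |Y| < mu. *)
Definition lt_presented (mu : Type) M : Prop :=
  exists (F : rmodType R) (B Y : set F) (p : {linear F -> M}),
    [/\ is_basis B,
        range p = setT /\ p @^-1` [set 0] = generated Y,
        card_lt B [set: mu] & card_lt Y [set: mu]].

Definition succ_index (I : eqType) (le : rel I) (i j : I) : Prop :=
  [/\ le i j, i != j & forall k, le i k -> le k j -> k = i \/ k = j].

Definition limit_index (I : eqType) (le : rel I) (i : I) : Prop :=
  (exists2 j, le j i & j != i) /\ ~ (exists j, succ_index le j i).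

(* [I] well-ordered by [le] with greatest element [d] is the set of the ordinals
   at most delta, [d] standing for delta itself. *)
Definition filtered C M : Prop :=
  exists (I : eqType) (le : rel I) (d : I) (F : I -> submodClosed M),
    (well_order le /\ forall i, le i d) /\
    [/\ forall i j, le i j -> {subset F i <= F j},
        forall i, (forall j, le i j) -> forall x, x \in F i <-> x = 0,
        forall x, x \in F d,
        forall i, limit_index le i ->
          forall x, x \in F i <->
            (exists2 j, le j i && (j != i) & x \in F j) &
        forall i j, succ_index le i j ->
          exists2 N, C N &
            isomorphic (quotient_type (restrict_submod (F i) (F j))) N].

Definition small_part (mu : Type) D : rmodType R -> Prop :=
  fun M => D M /\ lt_presented mu M.

Definition deconstructible (mu : Type) D : Prop :=
  forall M, D M <-> filtered (small_part mu D) M.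

End Deconstructible.

Section Embeddings.
Variable R : pzRingType.
Implicit Types M : rmodType R.

Definition is_RD_submodule M (N : submodClosed M) : Prop :=
  forall r : R^c,
    [set` N] `&` [set r *: m | m in [set: M]] = [set r *: n | n in [set` N]].

(* The system is sum_j x_j a_ij = b_i, for i < m, in the unknowns x_j, j < n. *)
Definition is_pure_submodule M (N : submodClosed M) : Prop :=
  forall (m n : nat) (a : 'M[R^c]_(m, n)) (b : 'I_m -> M),
    (forall i, b i \in N) ->
    (exists x : 'I_n -> M, forall i, \sum_j a i j *: x j = b i) ->
    exists2 x : 'I_n -> M, (forall j, x j \in N) &
      forall i, \sum_j a i j *: x j = b i.

Definition morphism_class := forall A B : rmodType R, {linear A -> B} -> Prop.

Definition embeddings : morphism_class := fun A B f => injective f.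

Definition RD_embeddings : morphism_class :=
  fun A B f => injective f /\ is_RD_submodule (linear_image f).

Definition pure_embeddings : morphism_class :=
  fun A B f => injective f /\ is_pure_submodule (linear_image f).

End Embeddings.

Section GaloisTypes.
Variables (R : pzRingType) (D : rmodType R -> Prop) (M : morphism_class R).

Definition le_M (B : rmodType R) (A : submodClosed B) : Prop :=
  [/\ D (submodule_type A), D B & M (submod_incl A)].

Definition D_embedding (A B : rmodType R) (f : {linear A -> B}) : Prop :=
  [/\ D A, D B, injective f & le_M (linear_image f)].

(* A triple (b, A, N), with b a tuple indexed by [I]; [A] being a submodule of
   [N] is rendered by a monomorphism [A -> N], so that a fixed [A] can be a
   submodule of several modules. *)
Record triple (I : Type) (A : rmodType R) := Triple {
  ambient : rmodType R;
  ambient_in_D : D ambient;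
  base_map : {linear A -> ambient};
  base_map_inj : injective base_map;
  tuple_of : I -> ambient }.

Definition atomically_related I A (t1 t2 : triple I A) : Prop :=
  exists (N : rmodType R)
    (f1 : {linear ambient t1 -> N}) (f2 : {linear ambient t2 -> N})
    (i : {linear A -> N}),
    [/\ D_embedding f1 /\ D_embedding f2,
        f1 \o base_map t1 =1 i,
        f2 \o base_map t2 =1 i &
        forall k, f1 (tuple_of t1 k) = f2 (tuple_of t2 k)].

Definition galois_equiv I A : triple I A -> triple I A -> Prop :=
  clos_trans (triple I A) (@atomically_related I A).

Definition gtp I A (t : triple I A) : triple I A -> Prop := galois_equiv t.

(* [D_embedding (base_map t)] says A <=_M N, as A is identified with its image;
   index type [unit]: single elements. *)
Definition gS (A : rmodType R) : Type :=
  {p : triple unit A -> Prop |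
    exists2 t : triple unit A, D_embedding (base_map t) & p = gtp t}.

(* The injection spells out |gS A| <= |L|: [gS A] is in too large a universe for
   the library's [#<=]. *)
Definition stable_in (L : Type) : Prop :=
  forall A : rmodType R, D A -> [set: A] #= [set: L] ->
    exists f : gS A -> L, injective f.

End GaloisTypes.

(* Main.v *)
From HB Require Import structures.
From mathcomp Require Import all_boot all_algebra.
From mathcomp Require Import all_classical wochoice.
From Stdlib Require Import Relation_Operators.
Require Import Defs.

Set Implicit Arguments.
Unset Strict Implicit.
Unset Printing Implicit Defensive.

Import GRing.Theory.

Local Open Scope classical_set_scope.
Local Open Scope card_scope.
Local Open Scope quotient_scope.
Local Open Scope ring_scope.

(** Let [A] be a module in [D] of cardinality lambda, embedded by a
    distinguished embedding in some [V] in [D], let [B] be its image, and let [x]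
    be an element of [V].  The idea is to find a submodule [X] of [V] that contains
    [x], has at most kappa elements, and is such that [B + X] is in [D] and is
    distinguished in [V].  Then the type of [x] over [A] can be computed in
    [B + X], and [B + X] is determined, up to an isomorphism over [A], by how [X]
    overlaps [B]; there are at most lambda to the kappa many ways to do so.  The
    atomic relations that witness this are the inclusion of [B + X] in [V] and the
    isomorphisms over [A].

    To have [B + X] in [D], fix filtrations of [V] and of [B] with small factors,
    and ask that [X] meet each factor of either filtration in 0 or in all of it
    ([closed_in]).  Then [X] inherits the filtration of [V] ([chain_restrict]),
    while [(B + X) / X], which is [B / (B `&` X)], inherits what is left of the
    filtration of [B]; put one after the other, the two give a filtration of
    [B + X] ([chain_extend]).  The closedness of [X] is a closure condition under
    kappa many unary functions: for each [y] in [X], add representatives of kappa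
    many generators of the factor in which [y] first appears ([chain_skolem]).

    To have [B + X] distinguished, it is enough that every finite system with
    right-hand side in [X] that is solvable modulo [B] be solved modulo [B] in [X]
    ([system_skolem], [pure_for_add]).  The three classes of embeddings differ only
    in the shape of the systems in the definition of purity
    ([morphism_class_shape]).

    So [X] is taken to be the set of values of all terms over a fixed set of kappa
    many symbols: [x] itself, linear combinations, and the Skolem functions
    ([spanned_restriction]).  Since the terms do not depend on [V], the overlap of
    [X] and [B] is recorded by a partial function from terms to [A], namely the
    one that sends a term to its value when this value is in [B].  It determines
    [B + X] over [A] together with [x] ([same_trace_isomorphism]), hence the type
    ([gS_code]).  Finally the functions from terms to a set of size lambda inject
    into that set, by currying along the construction of terms
    ([absorbs_term]). *)

(** * Exponents absorbed by a cardinal *)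

Section Absorbs.
Variable L : Type.

(** The inequality lambda ^ |A| <= lambda, as a property of the exponent: by the laws
    of exponents alone it passes from kappa to sums, products and sequences, hence to
    sets of terms. *)
Definition absorbs (A : Type) : Prop :=
  exists f : (A -> L) -> L, injective f.

Lemma absorbs_surj (A B : Type) (g : B -> A) :
  (forall a, exists b, g b = a) -> absorbs B -> absorbs A.
Proof.
move=> gsurj [f finj]; exists (fun u => f (u \o g)) => u v /finj uv.
by apply/funext => a; have [b <-] := gsurj a; rewrite -[LHS]/((u \o g) b) uv.
Qed.

Lemma absorbs_unit : absorbs unit.
Proof. by exists (fun u => u tt) => u v uv; apply/funext; case. Qed.

Lemma absorbs_sigma (A : Type) (B : A -> Type) :
  absorbs A -> (forall a, absorbs (B a)) -> absorbs {a : A & B a}.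
Proof.
move=> [f finj] hB; pose g a := projT1 (cid (hB a)).
have ginj a : injective (g a) := projT2 (cid (hB a)).
exists (fun u => f (fun a => g a (fun b => u (existT _ a b)))) => u v /finj uv.
apply/funext => -[a b]; have /ginj := congr1 (@^~ a) uv.
by move/(congr1 (@^~ b)).
Qed.

Lemma absorbs_prod (A B : Type) : absorbs A -> absorbs B -> absorbs (A * B).
Proof.
move=> hA hB; pose g (p : {a : A & B}) := (tag p, tagged p).
apply: (absorbs_surj (g := g)).
  by case=> a b; exists (existT _ a b).
exact: absorbs_sigma.
Qed.

Lemma absorbs_sum (A B : Type) :
  absorbs bool -> absorbs A -> absorbs B -> absorbs (A + B).
Proof.
move=> h2 hA hB.
pose T (b : bool) : Type := if b then A else B.
pose g (p : {b : bool & T b}) : (A + B)%type :=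
  match p with existT true a => inl a | existT false b => inr b end.
apply: (absorbs_surj (g := g)); last by apply: absorbs_sigma => //; case.
by case=> [a|b]; [exists (existT T true a) | exists (existT T false b)].
Qed.

Lemma absorbs_bool : absorbs nat -> absorbs bool.
Proof.
apply: (absorbs_surj (g := fun n => n == 0%N)).
by case; [exists 0%N | exists 1%N].
Qed.

Lemma absorbs_seq (A : Type) : absorbs nat -> absorbs A -> absorbs (seq A).
Proof.
move=> hN hA.
pose T n : Type := iter n (fun X => (A * X)%type) unit.
pose g := fix g n : T n -> seq A :=
  match n with 0%N => fun _ => [::] | m.+1 => fun p => p.1 :: g m p.2 end.
apply: (absorbs_surj (g := fun p : {n : nat & T n} => g (tag p) (tagged p))).
  elim=> [|a s [[n t] /= <-]]; first by exists (existT T 0%N tt).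
  by exists (existT T n.+1 (a, t)).
apply: absorbs_sigma => // n.
by elim: n => [|n IHn]; [exact: absorbs_unit | exact: absorbs_prod].
Qed.

Lemma absorbs_tree (A : Type) :
  absorbs nat -> absorbs A -> absorbs (GenTree.tree A).
Proof.
move=> hN hA.
pose g s := odflt (GenTree.Node 0 [::]) (@GenTree.decode A s).
apply: (absorbs_surj (g := g)).
  by move=> t; exists (GenTree.encode t); rewrite /g GenTree.codeK.
by apply: absorbs_seq => //; apply: absorbs_sum => //; apply: absorbs_bool.
Qed.

Lemma option_inj (l0 l1 : L) : absorbs bool -> l0 <> l1 ->
  exists f : option L -> L, injective f.
Proof.
move=> [f finj] l01.
(* the coordinate at true tells whether there is a value, the other one gives it *)
exists (fun o => f (fun b => if b then if o is Some _ then l1 else l0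
                             else odflt l0 o)).
move=> o1 o2 /finj e; move: (congr1 (@^~ true) e) (congr1 (@^~ false) e).
by case: o1 o2 {e} => [x|] [y|] //= => [_ -> // | /esym/l01 //].
Qed.

End Absorbs.

Lemma card_le_cover (T U : Type) (A : set T) (B : set U) (t0 : T) :
  A #<= B -> exists g : U -> T, A `<=` g @` B.
Proof.
elim/Ppointed: T => T in A t0 *; first by case: (no t0).
by move=> /pcard_surjP.
Qed.

(** * Submodules as sets *)

Section Submodules.
Variable S : pzRingType.
Implicit Types U V N : lmodType S.

Definition is_submodule V (P : set V) : Prop :=
  P 0 /\ forall a x y, P x -> P y -> P (a *: x + y).

(** A carrier for the canonical instance that turns a set closed under linear
    combinations into a [submodClosed] predicate. *)
Record submodule_set V := SubmoduleSet {
  carrier :> set V;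
  carrier_submodule : is_submodule carrier }.

Definition carrier_pred V (P : submodule_set V) : {pred V} :=
  fun x => x \in carrier P.

Lemma carrier_submod_closed V (P : submodule_set V) :
  submod_closed (carrier_pred P).
Proof.
have [P0 PL] := carrier_submodule P; split; first exact/mem_set.
by move=> a x y /set_mem Px /set_mem Py; apply/mem_set/PL.
Qed.

HB.instance Definition _ V (P : submodule_set V) :=
  GRing.isSubmodClosed.Build S V (carrier_pred P) (carrier_submod_closed P).

Definition submod_of V (P : set V) (sP : is_submodule P) : submodClosed V :=
  carrier_pred (SubmoduleSet sP).

Lemma submod_ofP V (P : set V) (sP : is_submodule P) x :
  x \in submod_of sP <-> P x.
Proof. by split=> [/set_mem|Px]; last exact/mem_set. Qed.

Lemma submodClosed_submodule V (A : submodClosed V) : is_submodule [set` A].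
Proof. by split=> [|a x y /= Ax Ay]; rewrite /= ?rpred0 ?rpredD ?rpredZ. Qed.

Section Closure.
Variables (V : lmodType S) (P : set V).
Hypothesis sP : is_submodule P.

Lemma submodule0 : P 0. Proof. by case: sP. Qed.

Lemma submoduleD x y : P x -> P y -> P (x + y).
Proof. by move=> Px Py; rewrite -[x]scale1r; apply: (proj2 sP). Qed.

Lemma submoduleZ a x : P x -> P (a *: x).
Proof. by move=> Px; rewrite -[_ *: x]addr0; apply: (proj2 sP) => //; case: sP. Qed.

Lemma submoduleB x y : P x -> P y -> P (x - y).
Proof. by move=> Px Py; rewrite addrC -scaleN1r; apply: (proj2 sP). Qed.

End Closure.

Lemma submoduleI V (P Q : set V) :
  is_submodule P -> is_submodule Q -> is_submodule (P `&` Q).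
Proof.
move=> sP sQ; split=> [|a x y [Px Qx] [Py Qy]].
  by split; apply: submodule0.
by split; [apply: (proj2 sP) | apply: (proj2 sQ)].
Qed.

Definition add_set V (P Q : set V) : set V :=
  [set z | exists x y, [/\ P x, Q y & z = x + y]].

Lemma submodule_add V (P Q : set V) :
  is_submodule P -> is_submodule Q -> is_submodule (add_set P Q).
Proof.
move=> sP sQ; split.
  by exists 0, 0; rewrite addr0; split=> //; apply: submodule0.
move=> a _ _ [x [y [Px Qy ->]]] [x' [y' [Px' Qy' ->]]].
exists (a *: x + x'), (a *: y + y'); split; [exact: (proj2 sP)|exact: (proj2 sQ)|].
by rewrite scalerDr addrACA.
Qed.

Lemma submodule_image U V (f : {linear U -> V}) (P : set U) :
  is_submodule P -> is_submodule (f @` P).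
Proof.
move=> sP; split; first by exists 0; [exact: submodule0 | rewrite linear0].
move=> a _ _ [x Px <-] [y Py <-]; exists (a *: x + y); last by rewrite linearP.
exact: (proj2 sP).
Qed.

Lemma submodule_preimage U V (f : {linear U -> V}) (P : set V) :
  is_submodule P -> is_submodule (f @^-1` P).
Proof.
move=> sP; split=> [|a x y Px Py] /=; rewrite ?linear0 ?linearP.
  exact: submodule0.
exact: (proj2 sP).
Qed.

Lemma linear_lift U V (f : {linear U -> V}) (A : submodClosed V) :
  (forall u, f u \in A) ->
  exists g : {linear U -> submodule_type A}, forall u, val (g u) = f u.
Proof.
move=> fA; pose g u : submodule_type A := Sub (f u) (fA u).
have gL : linear g by move=> a u v; apply: val_inj; rewrite linearP /= linearP.
pose mg := GRing.isLinear.Build _ _ _ _ g gL.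
pose gl : {linear U -> submodule_type A} := HB.pack g mg.
by exists gl.
Qed.

(** * Factors *)

(** The values of [h] on [Q] form an epimorphism from [Q] onto [N] with kernel [P].
    This encodes an isomorphism of [Q / P] and [N] on elements of [V], instead of
    on a quotient of a subtype. *)
Definition factor_map V N (P Q : set V) (h : V -> N) : Prop :=
  [/\ forall a x y, Q x -> Q y -> h (a *: x + y) = a *: h x + h y,
      forall x, Q x -> (h x = 0 <-> P x) &
      forall n, exists2 x, Q x & h x = n].

Lemma factor_map0 V N (P Q : set V) (h : V -> N) :
  is_submodule Q -> factor_map P Q h -> h 0 = 0.
Proof.
move=> sQ [hL _ _]; have Q0 := submodule0 sQ.
by have := hL (-1) 0 0 Q0 Q0; rewrite !scaleN1r oppr0 addr0 addNr.
Qed.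

Lemma factor_mapB V N (P Q : set V) (h : V -> N) x y :
  factor_map P Q h -> Q x -> Q y -> h (x - y) = h x - h y.
Proof. by case=> hL _ _ Qx Qy; rewrite addrC -scaleN1r hL // scaleN1r addrC. Qed.

Lemma factor_map_eq V N (P Q : set V) (h : V -> N) x y :
  is_submodule Q -> factor_map P Q h -> Q x -> Q y -> P (x - y) -> h x = h y.
Proof.
move=> sQ hf Qx Qy Pxy; apply/eqP; rewrite -subr_eq0 -(factor_mapB hf) //.
by apply/eqP; case: hf => _ -> //; apply: submoduleB.
Qed.

Section QuotientPi.
Variables (V : lmodType S) (A : submodClosed V).
Local Notation Q := (quotient_type A).

Lemma quotient_pi_eq (x y : V) : (\pi_Q x == \pi_Q y) = (x - y \in A).
Proof. by rewrite [RHS](Quotient.idealrBE (@zmod_pred S V A)). Qed.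

Lemma quotient_piP a (x y : V) : \pi_Q (a *: x + y) = a *: \pi_Q x + \pi_Q y.
Proof.
rewrite (raddfD (\pi_(Quotient.quot (@zmod_pred S V A)))); congr (_ + _).
apply/eqP; rewrite [_ == _]quotient_pi_eq -scalerBr rpredZ // -quotient_pi_eq.
by rewrite reprK.
Qed.

Lemma quotient_pi_eq0 (x : V) : (\pi_Q x == 0) = (x \in A).
Proof.
rewrite -[x in RHS]subr0 -quotient_pi_eq.
by rewrite (raddf0 (\pi_(Quotient.quot (@zmod_pred S V A)))).
Qed.
End QuotientPi.

Lemma quotient_factorP V (A B : submodClosed V) N :
  isomorphic (quotient_type (restrict_submod A B)) N <->
  exists h : V -> N, factor_map [set` A] [set` B] h.
Proof.
set C := restrict_submod A B; set Q := quotient_type C; split.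
- move=> [f [g fK gK]].
  pose h x := if insub x is Some u then f (\pi_Q (u : submodule_type B)) else 0.
  have hE (u : submodule_type B) : h (val u) = f (\pi_Q u) by rewrite /h valK.
  exists h; split.
  + move=> a x y Bx By; rewrite -[x]/(val (Sub x Bx : submodule_type B)).
    rewrite -[y]/(val (Sub y By : submodule_type B)) -linearP !hE.
    by rewrite quotient_piP linearP.
  + move=> x Bx; rewrite -[x]/(val (Sub x Bx : submodule_type B)) hE.
    have -> : (0 : N) = f 0 by rewrite linear0.
    split=> [/(can_inj fK)/eqP|Ax]; first by rewrite quotient_pi_eq0.
    by congr (f _); apply/eqP; rewrite quotient_pi_eq0.
  + move=> n; exists (val (repr (g n))); first exact: valP.
    by rewrite hE reprK gK.
- move=> [h hf]; have [hL hK hS] := hf; have sB := submodClosed_submodule B.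
  have hval (u v : submodule_type B) : \pi_Q u = \pi_Q v -> h (val u) = h (val v).
    move/eqP; rewrite quotient_pi_eq => uv.
    by apply: (factor_map_eq sB hf); rewrite -?raddfB //=; apply: valP.
  pose f (q : Q) : N := h (val (repr q)).
  have fE u : f (\pi_Q u) = h (val u) by apply: hval; rewrite reprK.
  have fL : linear f.
    move=> a; elim/quotW => x; elim/quotW => y.
    by rewrite -quotient_piP !fE linearP /= hL //; apply: valP.
  pose mf := GRing.isLinear.Build _ _ _ _ f fL.
  pose fl : {linear Q -> N} := HB.pack f mf.
  have /choice[g gh] : forall n, exists q, f q = n.
    by move=> n; have [x Bx <-] := hS n; exists (\pi_Q (Sub x Bx)); rewrite fE.
  exists fl, g => // q; elim/quotW: q => u; have := gh (f (\pi_Q u)).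
  elim/quotW: (g _) => v; rewrite !fE => e; apply/eqP; rewrite quotient_pi_eq.
  have : h (val (v - u)) = 0.
    by rewrite raddfB /= (factor_mapB hf) ?e ?subrr //; apply: valP.
  by move/hK => Avu; apply: Avu; apply: valP.
Qed.

End Submodules.

(** * Chains of submodules *)

Section WellOrders.
Variables (I : eqType) (le : rel I).
Hypothesis wo : well_order le.

Lemma wo_total : total le.
Proof.
move=> x y; have wc : wo_chain le predT by move=> A _; apply: wo.
exact: (wo_chainW wc).
Qed.

Lemma wo_refl : reflexive le.
Proof. by move=> x; rewrite -[le x x]orbb; apply: wo_total. Qed.

Lemma wo_anti : antisymmetric le.
Proof.
have wc : wo_chain le predT by move=> A _; apply: wo.
by move=> x y; apply: (wo_chain_antisymmetric wc).
Qed.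

Lemma wo_trans : transitive le.
Proof.
move=> y x z xy yz.
have [|m [[mA lm] _]] := wo (A := mem [:: x; y; z]).
  by exists x; rewrite !inE eqxx.
have [mx my mz] : [/\ le m x, le m y & le m z].
  by split; apply: lm; rewrite !inE eqxx ?orbT.
move: mA; rewrite !inE => /or3P[]/eqP e; rewrite e in mx my mz => //.
  by rewrite (@wo_anti x y) // xy mx.
by rewrite (@wo_anti z y) // ?my ?yz.
Qed.

Lemma wo_notle i j : ~~ le i j -> le j i && (j != i).
Proof.
move=> nij; have := wo_total i j; rewrite (negbTE nij) /= => ->.
by apply: contraNneq nij => ->; apply: wo_refl.
Qed.

Definition le_option (o1 o2 : option I) : bool :=
  match o1, o2 with
  | Some i, Some j => le i j
  | _, None => true
  | None, Some _ => false
  end.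

Lemma le_option_wo : well_order le_option.
Proof.
apply: antisymmetric_well_order.
  by move=> [i|] [j|] //= /wo_anti ->.
move=> A [a Aa]; have [[i Ai]|noA] := pselect (exists i, Some i \in A).
  have [|m [[mA lm] _]] := wo (A := fun i => Some i \in A); first by exists i.
  by exists (Some m); split=> // -[j|] //; apply: lm.
case: a Aa => [i Ai|AN]; first by case: noA; exists i.
by exists None; split=> // -[j Aj|] //; case: noA; exists j.
Qed.

End WellOrders.

Definition le_sum (I J : eqType) (leI : rel I) (leJ : rel J)
    (s t : (I + J)%type) : bool :=
  match s, t with
  | inl i, inl i' => leI i i'
  | inr j, inr j' => leJ j j'
  | inl _, inr _ => true
  | inr _, inl _ => false
  end.

Lemma le_sum_wo (I J : eqType) (leI : rel I) (leJ : rel J) :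
  well_order leI -> well_order leJ -> well_order (le_sum leI leJ).
Proof.
move=> woI woJ; apply: antisymmetric_well_order.
  by move=> [i|i] [j|j] //= => [/(wo_anti woI)|/(wo_anti woJ)] ->.
move=> A [a Aa]; have [[i Ai]|noA] := pselect (exists i, inl i \in A).
  have [|m [[mA lm] _]] := woI (fun i => inl i \in A); first by exists i.
  by exists (inl m); split=> // -[j|] //; apply: lm.
case: a Aa => [i Ai|j Aj]; first by case: noA; exists i.
have [|m [[mA lm] _]] := woJ (fun i => inr i \in A); first by exists j.
exists (inr m); split=> // -[i Ai|]; last by apply: lm.
by case: noA; exists i.
Qed.

Section Chains.
Variables (S : pzRingType) (C : lmodType S -> Prop).
Implicit Types U V N : lmodType S.

(** The union of the members of [F] with index in [p], with 0 adjoined for the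
    case that there are none. *)
Definition upto V (I : eqType) (F : I -> set V) (p : pred I) : set V :=
  [set x | x = 0 \/ exists2 i, p i & F i x].

Definition below V (I : eqType) (le : rel I) (F : I -> set V) (i : I) : set V :=
  upto F (fun j => le j i && (j != i)).

(** A [C]-filtration with a single kind of step: every member, at a limit as well,
    is compared with the union of the earlier ones.  A jump at a limit is then one
    more factor in [C], and a repeated member has factor zero.  Restricting,
    enlarging and concatenating chains thus involves no case distinction on the
    indices. *)
Definition C_chain V (T : set V) (I : eqType) (le : rel I) (F : I -> set V) :
    Prop :=
  [/\ well_order le, forall i, is_submodule (F i),
      forall i j, le i j -> F i `<=` F j, T = upto F predT &
      forall i, exists N (h : V -> N), C N /\ factor_map (below le F i) (F i) h].

Definition chained V (T : set V) : Prop :=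
  exists (I : eqType) (le : rel I) (F : I -> set V), C_chain T le F.

Section OneChain.
Variables (V : lmodType S) (T : set V) (I : eqType) (le : rel I) (F : I -> set V).
Hypothesis cF : C_chain T le F.

Lemma upto_submodule p : is_submodule (upto F p).
Proof.
case: cF => wo sF mF _ _; split=> [|a x y]; first by left.
have sZ i : F i x -> F i (a *: x) := @submoduleZ _ _ _ (sF i) a x.
case=> [->|[i pi Fx]]; first by rewrite scaler0 add0r.
case=> [->|[j pj Fy]]; right; first by exists i; rewrite // addr0; apply: sZ.
case/orP: (wo_total wo i j) => [ij|ji].
  by exists j => //; apply: (proj2 (sF j)) => //; apply: mF Fx.
by exists i => //; apply: (proj2 (sF i)) => //; apply: mF Fy.
Qed.

Lemma chain_submodule : is_submodule T.
Proof. by case: cF => _ _ _ -> _; apply: upto_submodule. Qed.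

Lemma below_sub i : below le F i `<=` F i.
Proof.
case: cF => wo sF mF _ _ x [->|[j /andP[ji _]]]; first exact: submodule0.
exact: mF.
Qed.

Lemma chain_sub i : F i `<=` T.
Proof. by case: cF => _ _ _ -> _ x Fx; right; exists i. Qed.

End OneChain.

Lemma factor_trivial V (P Q : set V) :
  (exists2 Z, C Z & forall z : Z, z = 0) -> is_submodule Q -> Q `<=` P ->
  exists N (h : V -> N), C N /\ factor_map P Q h.
Proof.
move=> [Z CZ Z0] sQ QP; exists Z, (fun=> 0); split=> //; split.
- by move=> *; rewrite scaler0 addr0.
- by move=> x /QP.
- by move=> n; exists 0; [exact: submodule0 | rewrite (Z0 n)].
Qed.


Lemma upto_image U V (f : {linear U -> V}) (I : eqType) (F : I -> set U) p :
  upto (fun i => f @` F i) p = f @` upto F p.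
Proof.
apply/seteqP; split=> [x [->|[i pi [u Fu <-]]]|_ [u [->|[i pi Fu]] <-]].
- by exists 0; [left | rewrite linear0].
- by exists u => //; right; exists i.
- by left; rewrite linear0.
- by right; exists i => //; exists u.
Qed.

Lemma chain_image U V (f : {linear U -> V}) (T : set U) (I : eqType) (le : rel I)
    (F : I -> set U) :
  injective f -> C_chain T le F -> C_chain (f @` T) le (fun i => f @` F i).
Proof.
move=> finj cF; have [wo sF mF -> fF] := cF; split=> //.
- by move=> i; apply: submodule_image.
- by move=> i j ij; apply/image_subset/mF.
- by rewrite upto_image.
move=> i; have [N [h [CN hf]]] := fF i; have [hL hK hS] := hf.
have [g fK] : exists g, cancel f g.
  have /choice[g gP] : forall v, exists u, (exists u', f u' = v) -> f u = v.
    move=> v; have [[u fu]|nov] := pselect (exists u', f u' = v); first by exists u.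
    by exists 0.
  by exists g => u; apply: finj; apply: gP; exists u.
exists N, (h \o g); split=> //; rewrite /below upto_image; split.
- move=> a _ _ [x Fx <-] [y Fy <-] /=.
  by rewrite -linearP !fK hL.
- move=> _ [x Fx <-] /=; rewrite fK; split=> [/(hK _ Fx)|[y Fy /finj e]].
    by exists x.
  by apply/(hK _ Fx); rewrite -e.
- by move=> n; have [x Fx <-] := hS n; exists (f x); [exists x | rewrite /= fK].
Qed.

(** [X] meets each factor of the chain in 0 or in all of it.  A chain induces a
    chain on such [X], and one on the factor module by [X], because each of its
    factors then goes entirely to one of the two. *)
Definition closed_in V (I : eqType) (le : rel I) (F : I -> set V) (X : set V) :=
  forall i, X `&` F i `<=` below le F i \/
            F i `<=` add_set (below le F i) (X `&` F i).

Lemma upto_setI V (I : eqType) (F : I -> set V) (X : set V) p :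
  X 0 -> upto (fun i => X `&` F i) p = X `&` upto F p.
Proof.
move=> X0; apply/seteqP; split=> [x [->|[i pi [Xx Fx]]]|x [Xx [->|[i pi Fx]]]].
- by split=> //; left.
- by split=> //; right; exists i.
- by left.
- by right; exists i.
Qed.

Hypothesis C0 : exists2 Z, C Z & forall z : Z, z = 0.

Lemma chain_restrict V (T X : set V) (I : eqType) (le : rel I) (F : I -> set V) :
  is_submodule X -> X `<=` T -> closed_in le F X -> C_chain T le F ->
  C_chain X le (fun i => X `&` F i).
Proof.
move=> sX XT clX cF; have [wo sF mF TE fF] := cF; have X0 := submodule0 sX.
have sXF i : is_submodule (X `&` F i) by apply: submoduleI.
split=> //.
- by move=> i j /mF Fij x [Xx /Fij].
- rewrite upto_setI // -TE; apply/seteqP; split=> x; last by case.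
  by move=> Xx; split=> //; apply: XT.
move=> i; rewrite /below upto_setI // -/(below le F i).
have [Xi|Fi] := clX i.
  by apply: factor_trivial => // x [Xx Fx]; split=> //; apply: Xi.
have [N [h [CN hf]]] := fF i; have [hL hK hS] := hf.
exists N, h; split=> //; split.
- by move=> a x y [_ Fx] [_ Fy]; apply: hL.
- move=> x [Xx Fx]; split=> [/(hK _ Fx)//|[_]]; exact: (proj2 (hK _ Fx)).
- move=> n; have [x Fx <-] := hS n; have [y [z [By [Xz Fz] e]]] := Fi _ Fx.
  exists z => //; apply: (factor_map_eq (sF i) hf) => //.
  rewrite e opprD addrCA subrr addr0 -[- y]sub0r.
  by apply: (submoduleB (upto_submodule cF _)) => //; left.
Qed.

Definition concat V (X : set V) (I J : eqType) (F : I -> set V) (G : J -> set V)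
    (s : (I + J)%type) : set V :=
  match s with inl i => F i | inr j => add_set (G j) X end.

(** The factor of [concat X F G] at [inr j] is that of [G j + X] by its
    predecessors, which is the factor of [G] at [j] when [X] meets that one in 0,
    and is 0 when [X] covers it. *)
Lemma chain_extend V (X B : set V) (I J : eqType) (leI : rel I) (leJ : rel J)
    (F : I -> set V) (G : J -> set V) :
  C_chain X leI F -> C_chain B leJ G -> closed_in leJ G X ->
  C_chain (add_set B X) (le_sum leI leJ) (concat X F G).
Proof.
move=> cF cG clX; have [woI sF mF XE fF] := cF; have [woJ sG mG BE fG] := cG.
have sX := chain_submodule cF.
have X_add P x : is_submodule P -> X x -> add_set P X x.
  by move=> sP Xx; exists 0, x; rewrite add0r; split=> //; apply: submodule0.
have belowr j : below (le_sum leI leJ) (concat X F G) (inr j) =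
                add_set (below leJ G j) X.
  apply/seteqP; split=> x.
    case=> [->|[[i|j'] /= lt]].
    - by apply: submodule0; apply: submodule_add => //; apply: upto_submodule cG _.
    - move=> Fx; apply: X_add; first exact: upto_submodule cG _.
      exact: (chain_sub cF Fx).
    - by move=> [y [z [Gy Xz ->]]]; exists y, z; split=> //; right; exists j'.
  case=> [y [z [[->|[j' lt Gy]] Xz ->]]].
    rewrite add0r; move: Xz; rewrite {1}XE => -[->|[i _ Fz]]; first by left.
    by right; exists (inl i).
  by right; exists (inr j') => //; exists y, z.
split.
- exact: le_sum_wo.
- by case=> [i|j] //=; apply: submodule_add.
- case=> [i|i] [j|j] //=; first exact: mF.
    by move=> _ x /(chain_sub cF); apply: X_add.
  by move=> /mG Gij x [y [z [Gy Xz ->]]]; exists y, z; split=> //; apply: Gij.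
- apply/seteqP; split=> x.
    case=> [y [z []]]; rewrite {1}BE => -[->|[j _ Gy]] Xz ->.
      rewrite add0r; move: Xz; rewrite {1}XE => -[->|[i _ Fz]]; first by left.
      by right; exists (inl i).
    by right; exists (inr j) => //; exists y, z.
  have sB := chain_submodule cG.
  case=> [->|[[i|j] _ /=]].
  + by apply: submodule0; apply: submodule_add.
  + by move=> Fx; apply: X_add => //; apply: (chain_sub cF Fx).
  + by move=> [y [z [Gy Xz ->]]]; exists y, z; split=> //; apply: (chain_sub cG Gy).
case=> [i|j].
  have -> : below (le_sum leI leJ) (concat X F G) (inl i) = below leI F i.
    apply/seteqP; split=> x [->|[]]; try by left.
    - by case=> [i'|//] /= lt Fx; right; exists i'.
    - by move=> i' lt Fx; right; exists (inl i').
  exact: fF.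
rewrite belowr /=; have sbG := upto_submodule cG (fun k => leJ k j && (k != j)).
have [Xj|Gj] := clX j; last first.
  apply: factor_trivial => //; first exact: submodule_add.
  move=> _ [y [z [Gy Xz ->]]]; have [u [v [bu [Xv _] ->]]] := Gj _ Gy.
  by exists u, (v + z); rewrite addrA; split=> //; apply: submoduleD.
have [N [h [CN hf]]] := fG j; have [hL hK hS] := hf.
have /choice[g gP] : forall x, exists y, add_set (G j) X x -> G j y /\ X (x - y).
  move=> x; have [[y [z [Gy Xz ->]]]|nox] := pselect (add_set (G j) X x).
    by exists y => _; rewrite addrAC subrr add0r.
  by exists 0 => /nox.
(* the component in [G j] is unique up to [X `&` G j], which [h] kills *)
have hg x y : add_set (G j) X x -> G j y -> X (x - y) -> h (g x) = h y.
  move=> /gP[Gg Xg] Gy Xy; apply: (factor_map_eq (sG j) hf) => //; apply: Xj.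
  split; last exact: submoduleB.
  have -> : g x - y = (x - y) - (x - g x) by rewrite opprB [RHS]addrC addrA subrK.
  exact: submoduleB.
have sGX := submodule_add (sG j) sX.
exists N, (h \o g); split=> //; split=> /=.
- move=> a x y Tx Ty; have [[Gx Xx] [Gy Xy]] := (gP _ Tx, gP _ Ty).
  rewrite -hL //; apply: hg; [exact: (proj2 sGX) | exact: (proj2 (sG j)) |].
  rewrite opprD addrACA -scalerBr; exact: (proj2 sX).
- move=> x Tx; have [Gx Xx] := gP _ Tx; split=> [/(hK _ Gx) bx|[y [z [by_ Xz e]]]].
    by exists (g x), (x - g x); split=> //; rewrite addrC subrK.
  have Gy := below_sub cG by_.
  rewrite (hg _ y) //; first exact/(hK _ Gy).
  by rewrite e addrAC subrr add0r.
- move=> n; have [x Gx <-] := hS n.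
  have Tx : add_set (G j) X x.
    by exists x, 0; rewrite addr0; split=> //; apply: submodule0.
  by exists x => //; apply: hg => //; rewrite subrr; apply: submodule0.
Qed.

End Chains.

(** * Chains and filtrations *)

Section Filtrations.
Variables (R : pzRingType) (C : rmodType R -> Prop).
Hypothesis C0 : exists2 Z, C Z & forall z : Z, z = 0.

(** A member at a limit, or the first one, has factor zero; this is where [C] needs
    a zero module. *)
Lemma filtered_chained (V : rmodType R) : filtered C V -> chained C [set: V].
Proof.
move=> [I [le [d [F [[wo dmax] [mF F0 Fd Flim Fsucc]]]]]].
exists I, le, (fun i => [set` F i]); split=> //.
- by move=> i; apply: submodClosed_submodule.
- by apply/seteqP; split=> // x _; right; exists d => //=; apply: Fd.
move=> i; have sFi := submodClosed_submodule (F i).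
have triv : [set` F i] `<=` below le (fun i => [set` F i]) i ->
    exists (N : rmodType R) (h : V -> N),
    C N /\ factor_map (below le (fun i => [set` F i]) i) [set` F i] h.
  exact: factor_trivial.
have [imin|] := pselect (forall j, le i j).
  by apply: triv => x /= /(F0 _ imin) ->; left.
move=> /existsNP[j /negP/(wo_notle wo)/andP[ji nji]].
have [[k ki]|nosucc] := pselect (exists k, succ_index le k i).
  have [N CN /quotient_factorP[h hf]] := Fsucc _ _ ki.
  exists N, h; split=> //.
  have -> // : below le (fun i => [set` F i]) i = [set` F k].
  have [leki nki kmax] := ki; apply/seteqP; split=> x; last first.
    by right; exists k; rewrite ?leki.
  case=> [->|[l /andP[li nli] /= Fl]] /=; first exact: rpred0.
  apply: mF Fl; apply: contraTT isT => /(wo_notle wo)/andP[kl nkl].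
  by have [e|e] := kmax _ kl li; rewrite e eqxx in nli nkl.
apply: triv => x /= /(proj1 (Flim _ _ _)) [|k ki Fk]; last by right; exists k.
by split=> //; exists j.
Qed.

(** Shifting the chain by one step makes it continuous: the filtration has the union
    of the members before [i] in place [i], and the whole module at the new last
    index [None]. *)
Lemma chained_filtered (V : rmodType R) (A : submodClosed V) :
  chained C [set` A] -> filtered C (submodule_type A).
Proof.
move=> [I [le [F cF]]]; have [wo sF mF AE fF] := cF.
pose lt (o : option I) : pred I :=
  if o is Some i then fun j => le j i && (j != i) else predT.
pose G o : set V := upto F (lt o).
have sG o : is_submodule (G o) by apply: upto_submodule cF _.
pose G' o : submodClosed (submodule_type A) :=
  submod_of (submodule_preimage (submod_incl A) (sG o)).
have G'P o x : x \in G' o <-> G o (val x) by apply: (iff_trans (submod_ofP _ _)).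
have lt_le j o : lt o j = le_option le (Some j) o && (Some j != o) by case: o.
have le_lt j o : ~~ le_option le o (Some j) -> lt o j.
  by case: o => [i|] //= /(wo_notle wo).
exists (option I), (le_option le), None, G'; split.
  by split; [exact: le_option_wo | case].
split.
- move=> o1 o2 le12 x /G'P[x0|[i lt1 Fx]]; apply/G'P; first by left.
  right; exists i => //; move: lt1; rewrite !lt_le => /andP[le1 ne1].
  have wo' := le_option_wo wo.
  rewrite (wo_trans wo' le1 le12); apply: contraNneq ne1 => e.
  by apply/eqP/(wo_anti wo'); rewrite le1 e le12.
- move=> o omin x; split=> [/G'P[x0|[i]]|->]; last exact: rpred0.
    exact: val_inj.
  rewrite lt_le => /andP[le1 ne1].
  by case/eqP: ne1; apply: (wo_anti (le_option_wo wo)); rewrite le1 omin.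
- move=> x; apply/G'P; have : [set` A] (val x) by apply: (valP x).
  by rewrite AE.
- move=> o [[o' leo ne] nosucc] x; split=> [/G'P[x0|[i]]|[o'' /andP[le1 ne1]]].
  + exists o'; first by rewrite leo.
    by apply/G'P; left.
  + rewrite lt_le => /andP[leio neio] Fx.
    (* [o] does not succeed [i], so some [k] lies between, where [F i] is included *)
    have : ~ forall k, le_option le (Some i) k ->
        le_option le k o -> k = Some i \/ k = o.
      by move=> all_; apply: nosucc; exists (Some i); split.
    move=> /existsNP[k /not_implyP[ik /not_implyP[ko /not_orP[ki kneo]]]].
    exists k; first by rewrite ko; apply/eqP.
    by apply/G'P; right; exists i => //; rewrite lt_le ik eq_sym; apply/eqP.
  + move=> /G'P[x0|[i lti Fx]]; apply/G'P; first by left.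
    right; exists i => //; move: lti; rewrite !lt_le => /andP[le2 ne2].
    have wo' := le_option_wo wo.
    rewrite (wo_trans wo' le2 le1); apply: contraNneq ne1 => e.
    by apply/eqP/(wo_anti wo'); rewrite le1 -e le2.
- move=> [i|] o [leio neio succ] //; last by case: o leio neio {succ}.
  have [N [h [CN hf]]] := fF i; have [hL hK hS] := hf; exists N => //.
  have GE : G o = F i.
    apply/seteqP; split=> x; last by right; exists i; rewrite // lt_le leio.
    case=> [->|[j ltj]]; first exact: submodule0 (sF i).
    apply: mF; apply: contraTT isT => /(wo_notle wo)/andP[ij ne].
    move: ltj; rewrite lt_le => /andP[lejo nejo].
    have [e|e] := succ (Some j) ij lejo; last by rewrite e eqxx in nejo.
    by case: e ne => ->; rewrite eqxx.
  have GoP x : x \in G' o <-> F i (val x) by rewrite -GE.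
  apply/quotient_factorP; exists (h \o val); split=> /=.
  + by move=> a x y /GoP Fx /GoP Fy; apply: hL.
  + by move=> x /GoP Fx; exact: iff_trans (hK _ Fx) (iff_sym (G'P (Some i) x)).
  + move=> n; have [x Fx <-] := hS n.
    have Ax : x \in A by apply: (chain_sub cF Fx).
    by exists (Sub x Ax) => //; apply/GoP.
Qed.

End Filtrations.

(** * Skolem functions *)

Section Skolem.
Variables (S : pzRingType) (K : Type).
Implicit Types V N : lmodType S.

Definition generating N (g : K -> N) : Prop :=
  forall P : set N, is_submodule P -> (forall k, P (g k)) -> forall x, P x.

(** A submodule that contains representatives of generators of the factor covers
    the factor, as its image in the factor is a submodule. *)
Lemma factor_generators V N (P Q : set V) (h : V -> N) (g : K -> N) :
  is_submodule Q -> factor_map P Q h -> generating g ->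
  exists s : K -> V, forall X, is_submodule X -> (forall k, X (s k)) ->
    Q `<=` add_set P (X `&` Q).
Proof.
move=> sQ hf gen; have [hL hK hS] := hf.
have /choice[s sP] : forall k, exists x, Q x /\ h x = g k.
  by move=> k; have [x Qx <-] := hS (g k); exists x.
exists s => X sX Xs y Qy.
have [|k|z [Xz Qz] hz] := gen (h @` (X `&` Q)) _ _ (h y).
- have h0 := factor_map0 sQ hf.
  split; first by exists 0 => //; split; apply: submodule0.
  move=> a _ _ [x [Xx Qx] <-] [x' [Xx' Qx'] <-]; exists (a *: x + x').
    by split; [exact: (proj2 sX) | exact: (proj2 sQ)].
  exact: hL.
- by have [Qs <-] := sP k; exists (s k).
exists (y - z), z; split; rewrite ?subrK //.
apply/(hK _ (submoduleB sQ Qy Qz)).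
by rewrite (factor_mapB hf) // hz subrr.
Qed.

(** A nonzero [x] has a rank, the unique [i] such that [x] is in [F i] and not
    below [i]; [op x] lists representatives of generators of the factor at the rank
    of [x].  So if [X] is closed under [op] and meets the factor at [i] outside 0,
    it covers that factor. *)
Lemma chain_skolem (C : lmodType S -> Prop) V (T : set V) (I : eqType) (le : rel I)
    (F : I -> set V) :
  (forall N, C N -> exists g : K -> N, generating g) -> C_chain C T le F ->
  exists op : V -> K -> V, forall X, is_submodule X ->
    (forall x k, X x -> X (op x k)) -> closed_in le F X.
Proof.
move=> smallC [wo sF mF _ fF].
have /choice[s sP] : forall i, exists s : K -> V, forall X, is_submodule X ->
    (forall k, X (s k)) -> F i `<=` add_set (below le F i) (X `&` F i).
  move=> i; have [N [h [CN hf]]] := fF i; have [g gen] := smallC _ CN.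
  exact: factor_generators hf gen.
have rank_uniq x i j :
    F i x -> ~ below le F i x -> F j x -> ~ below le F j x -> i = j.
  move=> Fi bi Fj bj; apply/eqP/contraT => ne.
  have /orP[ij|ji] := wo_total wo i j.
    by case: bj; right; exists i; rewrite // ij.
  by case: bi; right; exists j; rewrite // ji eq_sym.
have /choice[op opP] : forall x, exists f,
    forall i, F i x -> ~ below le F i x -> f = s i.
  move=> x.
  have [[i [Fi bi]]|no_rank] := pselect (exists i, F i x /\ ~ below le F i x).
    by exists (s i) => j Fj bj; congr s; apply: rank_uniq bj.
  by exists (fun=> 0) => i Fi bi; case: no_rank; exists i.
exists op => X sX Xop i; have [|/existsNP[x /not_implyP[[Xx Fx] bx]]] :=
    pselect (X `&` F i `<=` below le F i); first by left.
by right; apply: sP => // k; rewrite -(opP x) //; apply: Xop.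
Qed.

Definition solves_modulo V (B X : set V) : Prop :=
  forall (m n : nat) (a : 'M[S]_(m, n)) (b : 'I_m -> V),
    (forall i, X (b i)) ->
    (exists x : 'I_n -> V, forall i, B (\sum_j a i j *: x j - b i)) ->
    exists2 x : 'I_n -> V, (forall j, X (x j)) &
      forall i, B (\sum_j a i j *: x j - b i).

(** A symbol [(m, n, rows, j)] stands for the unknown [j] of the system of [m]
    equations in [n] unknowns with coefficients [rows]; the arguments are the
    right-hand side. *)
Lemma system_skolem V (B : set V) :
  exists op : nat * nat * seq (seq S) * nat -> seq V -> V, forall X : set V,
    (forall c s, (forall x, x \in s -> X x) -> X (op c s)) -> solves_modulo B X.
Proof.
pose sys (c : nat * nat * seq (seq S) * seq V) (x : nat -> V) :=
  forall i : 'I_c.1.1.1,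
    B (\sum_(j < c.1.1.2) nth (0 : S) (nth [::] c.1.2 i) j *: x j
       - nth (0 : V) c.2 i).
have /choice[sol solP] : forall c, exists x, (exists x', sys c x') -> sys c x.
  move=> c; have [[x sx]|nox] := pselect (exists x, sys c x); first by exists x.
  by exists (fun=> 0) => /nox.
exists (fun c s => sol (c.1.1.1, c.1.1.2, c.1.2, s) c.2) => X Xop m n a b Xb [x xP].
pose rows := [seq [seq a i j | j <- enum 'I_n] | i <- enum 'I_m].
pose s := [seq b i | i <- enum 'I_m].
have rowsE (i : 'I_m) (j : 'I_n) : nth 0 (nth [::] rows i) j = a i j.
  rewrite (nth_map i) ?size_enum_ord // nth_ord_enum.
  by rewrite (nth_map j) ?size_enum_ord // nth_ord_enum.
have sE (i : 'I_m) : nth 0 s i = b i.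
  by rewrite (nth_map i) ?size_enum_ord // nth_ord_enum.
have sysE (y : nat -> V) : sys (m, n, rows, s) y <->
    forall i, B (\sum_(j < n) a i j *: y j - b i).
  split=> yP i; have := yP i; rewrite /= sE; congr (B (_ - _));
  by apply: eq_bigr => j _; rewrite rowsE.
exists (fun j => sol (m, n, rows, s) j).
  by move=> j; apply: (Xop (m, n, rows, nat_of_ord j)) => _ /mapP[i _ ->].
apply/sysE/solP; exists (fun k => if insub k is Some j then x j else 0).
apply/sysE => i; have := xP i; congr (B (_ - _)).
by apply: eq_bigr => j _; rewrite valK.
Qed.

End Skolem.

(** Fewer than kappa^+ generators are at most kappa many. *)
Lemma lt_presented_generated (R : pzRingType) (K Kp : Type) (N : rmodType R) :
  is_succ_card K Kp -> lt_presented Kp N -> exists g : K -> N, generating g.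
Proof.
move=> [_ KpP] [F [B [Y [p [[genB _] [psurj _] ltB _]]]]].
have leB : B #<= [set: K].
  have [/card_subP[A eqAB _] nleB] := ltB.
  rewrite -(card_le_eql eqAB); apply: KpP; split.
    by rewrite (card_le_eql eqAB); case: ltB.
  by rewrite (card_le_eqr eqAB).
have [e eB] := card_le_cover (0 : F) leB.
exists (p \o e) => P sP Pe n.
have [x _ <-] : range p n by rewrite psurj.
have : generated B x by rewrite genB.
move=> /(_ (submod_of (submodule_preimage p sP))) Bx.
apply/(submod_ofP (submodule_preimage p sP))/Bx => y /eB[k _ <-].
exact/submod_ofP/Pe.
Qed.

(** * Purity relative to a set of shapes of systems *)

Section Purity.
Variables (S : pzRingType) (shape : nat -> nat -> Prop).
Implicit Types U V : lmodType S.

(** With no shape, the 1 x 1 shape, or all shapes, these are all submodules, the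
    RD-submodules, and the pure submodules, respectively. *)
Definition pure_for V (N : set V) : Prop :=
  forall (m n : nat) (a : 'M[S]_(m, n)) (b : 'I_m -> V), shape m n ->
    (forall i, N (b i)) ->
    (exists x : 'I_n -> V, forall i, \sum_j a i j *: x j = b i) ->
    exists2 x : 'I_n -> V, (forall j, N (x j)) &
      forall i, \sum_j a i j *: x j = b i.

Lemma pure_for_setT V : pure_for [set: V].
Proof. by move=> m n a b _ _ [x xP]; exists x. Qed.

Lemma pure_for_preimage U V (g : {linear U -> V}) (N : set U) :
  injective g -> pure_for (g @` N) -> pure_for N.
Proof.
move=> ginj pN m n a b sh Nb [x xP].
have gsum (y : 'I_n -> U) i : g (\sum_j a i j *: y j) = \sum_j a i j *: g (y j).
  by rewrite linear_sum; apply: eq_bigr => j _; rewrite linearZ.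
have [| |y gy yP] := pN m n a (g \o b) sh.
- by move=> i; exists (b i).
- by exists (g \o x) => i /=; rewrite -gsum xP.
have /choice[z zP] : forall j, exists z, N z /\ g z = y j.
  by move=> j; have [z Nz <-] := gy j; exists z.
exists z => [j|i]; first by case: (zP j).
apply: ginj; rewrite gsum -[RHS]yP; apply: eq_bigr => j _.
by case: (zP j) => _ ->.
Qed.

(** A solution over the sum is found modulo [B] in [X] and then corrected in [B],
    by the purity of [B]. *)
Lemma pure_for_add V (B X : set V) :
  is_submodule B -> pure_for B -> solves_modulo B X -> pure_for (add_set B X).
Proof.
move=> sB pB solX m n a b sh Tb [x xP].
have /choice[c cP] : forall i, exists c, B (b i - c) /\ X c.
  by move=> i; have [u [v [Bu Xv ->]]] := Tb i; exists v; rewrite addrK.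
have [| |y Xy yP] := solX m n a c.
- by move=> i; case: (cP i).
- by exists x => i; rewrite xP; case: (cP i).
have [| |z Bz zP] := pB m n a (fun i => b i - \sum_j a i j *: y j) sh.
- move=> i.
  have -> : b i - \sum_j a i j *: y j = (b i - c i) - (\sum_j a i j *: y j - c i).
    by rewrite opprB addrA subrK.
  by apply: submoduleB => //; case: (cP i).
- exists (fun j => x j - y j) => i; rewrite -xP -sumrB.
  by apply: eq_bigr => j _; rewrite scalerBr.
exists (fun j => z j + y j) => [j|i]; first by exists (z j), (y j).
under eq_bigr do rewrite scalerDr.
by rewrite big_split /= zP subrK.
Qed.

End Purity.

Lemma linear_imageE (S : pzRingType) (U V : lmodType S) (f : {linear U -> V}) :
  [set` linear_image f] = range f.
Proof. by apply/seteqP; split=> x; [move/set_mem | move/mem_set]. Qed.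

Lemma RD_pure_for (R : pzRingType) (V : rmodType R) (N : submodClosed V) :
  is_RD_submodule N <-> pure_for (fun m n => m = 1%N /\ n = 1%N) [set` N].
Proof.
split=> [rdN m n a b [em en]|pN r].
  subst m n => Nb [x xP].
  have [y Ny ey] : [set a ord0 ord0 *: n | n in [set` N]] (b ord0).
    by rewrite -rdN; split=> //; exists (x ord0); rewrite // -xP big_ord1.
  by exists (fun=> y) => // i; rewrite big_ord1 ord1.
apply/seteqP; split=> [y [Ny [x _ e]]|_ [y Ny <-]]; last first.
  by split; [exact: rpredZ | exists y].
have [//| |z Nz zP] := pN 1%N 1%N (const_mx r) (fun=> y) (conj erefl erefl).
- by exists (fun=> x) => i; rewrite big_ord1 mxE.
by exists (z ord0); rewrite // -(zP ord0) big_ord1 mxE.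
Qed.

Lemma morphism_class_shape (R : pzRingType) (M : morphism_class R) :
  M = @embeddings R \/ M = @RD_embeddings R \/ M = @pure_embeddings R ->
  exists shape, forall (U V : rmodType R) (f : {linear U -> V}),
    M U V f <-> injective f /\ pure_for shape (range f).
Proof.
case=> [->|[->|->]].
- by exists (fun _ _ => False) => U V f; split=> [finj|[]//]; split.
- exists (fun m n => m = 1%N /\ n = 1%N) => U V f; rewrite -linear_imageE.
  by split=> -[finj /RD_pure_for rdf].
- exists (fun _ _ => True) => U V f; rewrite -linear_imageE.
  split=> -[finj pf]; split=> // m n a b; first by move=> _; exact: pf.
  exact: pf.
Qed.

(** * Terms *)

(** The symbols stand for the element whose type is considered, the linear
    combinations of two elements, the Skolem functions of the filtrations of the
    ambient module and of the base, and the solutions of systems. *)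
Inductive symbol (S : pzRingType) (K : Type) : Type :=
  | Point
  | Comb of S
  | AmbientGen of K
  | BaseGen of K
  | Solve of nat * nat * seq (seq S) * nat.

Arguments Point {S K}.
Arguments Comb {S K}.
Arguments AmbientGen {S K}.
Arguments BaseGen {S K}.
Arguments Solve {S K}.

Definition term (S : pzRingType) (K : Type) : Type := GenTree.tree (symbol S K).

Definition point {S : pzRingType} {K : Type} : term S K := GenTree.Leaf Point.

Section Terms.
Variables (S : pzRingType) (K : Type).
Local Notation symbol := (symbol S K).
Local Notation term := (term S K).

Definition comb (a : S) (t u : term) : term :=
  GenTree.Node 0 [:: GenTree.Leaf (Comb a); t; u].

(** The symbol of a node is carried by the leaf in front of its arguments; trees of
    any other form have value 0. *)
Fixpoint eval (V : lmodType S) (op : symbol -> seq V -> V) (t : term) : V :=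
  match t with
  | GenTree.Leaf k => op k [::]
  | GenTree.Node _ (GenTree.Leaf k :: ts) => op k (map (eval op) ts)
  | _ => 0
  end.

Lemma eval_closed (V : lmodType S) (op : symbol -> seq V -> V) k s :
  (forall x, x \in s -> range (eval op) x) -> range (eval op) (op k s).
Proof.
move=> sX; have [ts <-] : exists ts, map (eval op) ts = s.
  elim: s sX => [|x s IHs] sX; first by exists [::].
  have [t _ tx] := sX x (mem_head _ _).
  have [|ts tss] := IHs; first by move=> y ys; apply: sX; rewrite inE ys orbT.
  by exists (t :: ts); rewrite /= tx tss.
by exists (GenTree.Node 0 (GenTree.Leaf k :: ts)).
Qed.

Lemma absorbs_term (L : Type) :
  absorbs L nat -> absorbs L S -> absorbs L K -> absorbs L term.
Proof.
move=> hN hS hK.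
have h2 := absorbs_bool hN; apply: absorbs_tree => //.
pose g (s : unit + (S + (K + (K + nat * nat * seq (seq S) * nat)))) : symbol :=
  match s with
  | inl _ => Point
  | inr (inl a) => Comb a
  | inr (inr (inl k)) => AmbientGen k
  | inr (inr (inr (inl k))) => BaseGen k
  | inr (inr (inr (inr c))) => Solve c
  end.
apply: (absorbs_surj (g := g)).
  case=> [|a|k|k|c]; [exists (inl tt) | exists (inr (inl a)) |
    exists (inr (inr (inl k))) | exists (inr (inr (inr (inl k)))) |
    exists (inr (inr (inr (inr c))))] => //.
apply: absorbs_sum => //; first exact: absorbs_unit.
do 3![apply: absorbs_sum => //].
do 2![apply: absorbs_prod => //]; first exact: absorbs_prod.
by do 2![apply: absorbs_seq => //].
Qed.

Definition spanned_by_terms (A V : lmodType S) (base : A -> V) (ev : term -> V) :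
    Prop :=
  (forall a t u, ev (comb a t u) = a *: ev t + ev u) /\
  forall x, exists m t, x = base m + ev t.

(** An equality between two elements [base m + ev t] says that [ev] takes a certain
    value in the base at a difference of two terms, which is again a term. *)
Lemma same_trace_functional (A V W : lmodType S) (bV : {linear A -> V})
    (bW : {linear A -> W}) evV evW :
  spanned_by_terms bV evV -> spanned_by_terms bW evW ->
  (forall t m, bV m = evV t -> bW m = evW t) ->
  forall m m' t t',
    bV m + evV t = bV m' + evV t' -> bW m + evW t = bW m' + evW t'.
Proof.
move=> [lV _] [lW _] tr m m' t t' e.
have := tr (comb (-1) t t') (m - m').
rewrite lV lW !scaleN1r !raddfB => e'.
have /e' E : bV m - bV m' = - evV t + evV t'.
  by rewrite -[bV m](addrK (evV t)) e addrAC [bV m' + _]addrC addrK addrC.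
by rewrite -[bW m](subrK (bW m')) E addrC -addrA addNKr addrC.
Qed.

Lemma same_trace_isomorphism (A V W : lmodType S) (bV : {linear A -> V})
    (bW : {linear A -> W}) evV evW :
  spanned_by_terms bV evV -> spanned_by_terms bW evW ->
  (forall t m, bV m = evV t <-> bW m = evW t) ->
  exists g : {linear V -> W}, [/\ injective g, range g = setT &
    forall m t, g (bV m + evV t) = bW m + evW t].
Proof.
move=> sV sW tr; have [[lV genV] [lW genW]] := (sV, sW).
have VW := same_trace_functional sV sW (fun t m => proj1 (tr t m)).
have WV := same_trace_functional sW sV (fun t m => proj2 (tr t m)).
have /choice[g gP] : forall x, exists y,
    forall m t, x = bV m + evV t -> y = bW m + evW t.
  move=> x; have [m [t ->]] := genV x; exists (bW m + evW t) => m' t'; exact: VW.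
have gE m t : g (bV m + evV t) = bW m + evW t by apply: gP.
have gL : linear g.
  move=> a x y; have [m [t ->]] := genV x; have [m' [t' ->]] := genV y.
  rewrite scalerDr addrACA -lV -linearP !gE lW linearP.
  by rewrite scalerDr addrACA.
pose mg := GRing.isLinear.Build _ _ _ _ g gL.
pose gl : {linear V -> W} := HB.pack g mg.
exists gl; split=> //.
- move=> x y; have [m [t ->]] := genV x; have [m' [t' ->]] := genV y.
  by rewrite /= !gE; apply: WV.
- apply/seteqP; split=> // y _; have [m [t ->]] := genW y.
  by exists (bV m + evV t); rewrite // gE.
Qed.

End Terms.

(** * Galois types *)

Section Deconstructible.
Variables (R : pzRingType) (K Kp : Type) (D : rmodType R -> Prop).
Hypothesis hKp : is_succ_card K Kp.
Hypothesis hD : deconstructible Kp D.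

Lemma zero_small : exists2 Z : rmodType R, small_part Kp D Z & forall z : Z, z = 0.
Proof.
pose Z : rmodType R := 'rV[R^c]_0.
have Z0 (z : Z) : z = 0 by exact: thinmx0.
have sT : is_submodule [set: Z] by [].
exists Z => //; split.
  apply/hD; exists unit, (fun _ _ => true), tt, (fun _ => submod_of sT).
  split; split=> //.
  - by move=> P [[] Pt]; exists tt; split=> [|[] //]; split=> // -[].
  - by move=> i j _ x.
  - by move=> i _ x; split=> [_|_]; [exact: Z0 | apply/submod_ofP].
  - by move=> x; apply/submod_ofP.
  - by move=> [] [[[]]].
  - by move=> [] [] [].
have lt0 : card_lt (set0 : set Z) [set: Kp].
  split=> // le0; case: hKp => -[_ nle] _; apply: nle.
  exact: (card_le_trans le0).
exists Z, set0, set0, idfun; split=> //.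
- split; last by move=> s c _ s0 _ x /s0.
  by apply/seteqP; split=> // x _ A _; rewrite (Z0 x) rpred0.
- split; first by apply/seteqP; split=> // x _; exists x.
  by apply/seteqP; split=> // x _ ; [move=> A _ | ]; rewrite (Z0 x) //= rpred0.
Qed.

Lemma deconstructible_chained (V : rmodType R) :
  D V -> chained (small_part Kp D) [set: V].
Proof. by move/hD; apply: filtered_chained; apply: zero_small. Qed.

Lemma chained_deconstructible (V : rmodType R) (A : submodClosed V) :
  chained (small_part Kp D) [set` A] -> D (submodule_type A).
Proof. by move=> cA; apply/hD; apply: chained_filtered. Qed.

Lemma deconstructible_image (U V : rmodType R) (f : {linear U -> V}) :
  injective f -> D U -> D (submodule_type (linear_image f)).
Proof.
move=> finj /deconstructible_chained[I [le [F cF]]].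
apply: chained_deconstructible; rewrite linear_imageE.
by exists I, le, (fun i => f @` F i); apply: chain_image.
Qed.

Lemma small_generated (N : rmodType R) :
  small_part Kp D N -> exists g : K -> N, generating g.
Proof. by case=> _; apply: lt_presented_generated. Qed.

Section Shape.
Variables (M : morphism_class R) (shape : nat -> nat -> Prop).
Hypothesis MP : forall (U V : rmodType R) (f : {linear U -> V}),
  M f <-> injective f /\ pure_for shape (range f).

Lemma range_submod_incl (V : rmodType R) (A : submodClosed V) :
  range (submod_incl A) = [set` A].
Proof.
apply/seteqP; split=> [_ [u _ <-]|x Ax]; first exact: valP.
by exists (Sub x Ax).
Qed.

Lemma D_embeddingP (U V : rmodType R) (f : {linear U -> V}) :
  D_embedding D M f <->
  [/\ D U, D V, injective f & pure_for shape (range f)].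
Proof.
split=> [[DU DV finj [_ _ /MP[_]]]|[DU DV finj pf]].
  by rewrite range_submod_incl linear_imageE.
split=> //; split=> //; first exact: deconstructible_image.
apply/MP; split; first exact: val_inj.
by rewrite range_submod_incl linear_imageE.
Qed.

Lemma atomically_related_sym (A : rmodType R) (I : Type) (t u : triple D I A) :
  atomically_related M t u -> atomically_related M u t.
Proof.
by move=> [N [f [g [i [[Df Dg] fi gi fg]]]]]; exists N, g, f, i; split.
Qed.

Lemma gtp_eq (A : rmodType R) (I : Type) (t u : triple D I A) :
  atomically_related M t u -> gtp M t = gtp M u.
Proof.
move=> tu; apply/funext => v; apply/propext; split=> h.
  by apply: t_trans h; apply: t_step; apply: atomically_related_sym.
by apply: t_trans h; apply: t_step.
Qed.

(** The ambient module of [u] is the submodule [B + X] of the ambient module of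
    [t], where [B] is the image of [A] and [X] the set of values of terms.  As [X]
    is closed under the Skolem functions of both filtrations, [B + X] has the chain
    of [X] followed by that of [B] modulo [X], hence is in [D]; and the solutions of
    systems modulo [B] make it a distinguished submodule. *)
Lemma spanned_restriction (A : rmodType R) (t : triple D unit A) :
  D_embedding D M (base_map t) ->
  exists (u : triple D unit A) (ev : term R^c K -> ambient u),
    [/\ D_embedding D M (base_map u), atomically_related M t u,
        spanned_by_terms (base_map u) ev & ev point = tuple_of u tt].
Proof.
move=> Dt; have [DA DV binj pB] := proj1 (D_embeddingP _) Dt.
set V := ambient t in DV *.
set base : {linear A -> V} := base_map t in binj pB Dt *.
have [I [leI [F cF]]] := deconstructible_chained DV.
have [J [leJ [G0 cG0]]] := deconstructible_chained DA.
have cG := chain_image binj cG0.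
have [opF opFP] := chain_skolem small_generated cF.
have [opG opGP] := chain_skolem small_generated cG.
have [opS opSP] := system_skolem (range base).
pose op (k : symbol R^c K) (s : seq V) : V :=
  match k with
  | Point => tuple_of t tt
  | Comb a => a *: nth 0 s 0 + nth 0 s 1
  | AmbientGen k => opF (nth 0 s 0) k
  | BaseGen k => opG (nth 0 s 0) k
  | Solve c => opS c s
  end.
pose X : set V := range (eval op).
have X_op k s : (forall x, x \in s -> X x) -> X (op k s) by exact: eval_closed.
have sX : is_submodule X.
  split; first by exists (GenTree.Node 0 [::]).
  move=> a x y Xx Xy; apply: (X_op (Comb a) [:: x; y]) => z.
  by rewrite !inE => /orP[]/eqP ->.
have clF : closed_in leI F X.
  apply: opFP => // x k Xx; apply: (X_op (AmbientGen k) [:: x]) => z.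
  by rewrite inE => /eqP ->.
have clG : closed_in leJ (fun j => base @` G0 j) X.
  apply: opGP => // x k Xx; apply: (X_op (BaseGen k) [:: x]) => z.
  by rewrite inE => /eqP ->.
have solX : solves_modulo (range base) X.
  by apply: opSP => c s; apply: (X_op (Solve c)).
have cX := chain_restrict zero_small sX (@subsetT _ X) clF cF.
have cT := chain_extend zero_small cX cG clG.
have sB : is_submodule (range base) by apply: submodule_image.
have sT := submodule_add sB sX.
pose T := submod_of sT.
have TE : [set` T] = add_set (range base) X.
  by apply/seteqP; split=> x /(submod_ofP sT).
have T_X x : X x -> x \in T.
  move=> Xx; apply/submod_ofP; exists 0, x; rewrite add0r; split=> //.
  exact: submodule0.
have T_B m : base m \in T.
  apply/submod_ofP; exists (base m), 0; rewrite addr0; split=> //.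
  exact: submodule0.
have DT : D (submodule_type T).
  by apply: chained_deconstructible; rewrite TE; eexists _, _, _; exact: cT.
have [baseT baseTE] := linear_lift T_B.
have baseT_inj : injective baseT by move=> m m' e; apply: binj; rewrite -!baseTE e.
have T_ev w : eval op w \in T by apply: T_X; exists w.
pose ev w : submodule_type T := Sub (eval op w) (T_ev w).
pose u : triple D unit A := Triple DT baseT_inj (fun=> ev point).
exists u, ev.
have Dincl : D_embedding D M (submod_incl T).
  apply/D_embeddingP; split=> //.
  by rewrite range_submod_incl TE; apply: pure_for_add.
have Did : D_embedding D M (idfun : {linear V -> V}).
  apply/D_embeddingP; split=> //; have -> : range (idfun : V -> V) = setT.
    by apply/seteqP; split=> // x _; exists x.
  exact: pure_for_setT.
split=> //.
- apply/D_embeddingP; split=> //=; apply: (pure_for_preimage (g := submod_incl T)).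
    exact: val_inj.
  suff -> : submod_incl T @` range baseT = range base by [].
  apply/seteqP; split=> [_ [_ [m _ <-] <-]|_ [m _ <-]].
    by exists m => //; rewrite -baseTE.
  by exists (baseT m) => //; rewrite -baseTE.
- by exists V, idfun, (submod_incl T), base; split=> // -[].
- split=> [a w w'|x]; first exact: val_inj.
  have [_ [_ [[m _ <-] [w _ <-] e]]] := proj1 (submod_ofP sT _) (valP x).
  by exists m, w; apply: val_inj; rewrite e -baseTE.
Qed.

Lemma same_trace_related (A : rmodType R) (t u : triple D unit A)
    (et : term R^c K -> ambient t) (eu : term R^c K -> ambient u) :
  spanned_by_terms (base_map t) et -> spanned_by_terms (base_map u) eu ->
  et point = tuple_of t tt -> eu point = tuple_of u tt ->
  (forall w m, base_map t m = et w <-> base_map u m = eu w) ->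
  atomically_related M t u.
Proof.
move=> st su pt pu tr.
have [g [ginj gsurj gE]] := same_trace_isomorphism st su tr.
have D_onto (V : rmodType R) (f : {linear V -> ambient u}) :
    D V -> injective f -> range f = setT -> D_embedding D M f.
  move=> DV finj fT; apply/D_embeddingP; split=> //; first exact: ambient_in_D.
  by rewrite fT; apply: pure_for_setT.
have Did : D_embedding D M (idfun : {linear ambient u -> ambient u}).
  apply: D_onto => //; first exact: ambient_in_D.
  by apply/seteqP; split=> // x _; exists x.
(* a term with value 0, so that elements of the base are of the form [base m + ev t] *)
pose z := comb (-1) point point : term R^c K.
have zt : et z = 0 by case: st => -> _; rewrite scaleN1r addNr.
have zu : eu z = 0 by case: su => -> _; rewrite scaleN1r addNr.
exists (ambient u), g, idfun, (base_map u); split=> //.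
- by split=> //; apply: D_onto => //; exact: ambient_in_D.
- by move=> m /=; rewrite -[base_map t m]addr0 -zt gE zu addr0.
- case; have := gE 0 point.
  by rewrite pt pu !linear0 !add0r.
Qed.

(** The code of a type is the partial function that a term-spanned representative
    induces from terms to [A]; types with the same code have isomorphic
    representatives. *)
Lemma gS_code (A : rmodType R) :
  exists f : gS D M A -> (term R^c K -> option A), injective f.
Proof.
pose codes (p : gS D M A) (c : term R^c K -> option A) : Prop :=
  exists (u : triple D unit A) (ev : term R^c K -> ambient u),
    [/\ sval p = gtp M u, spanned_by_terms (base_map u) ev,
        ev point = tuple_of u tt &
        forall w m, base_map u m = ev w <-> c w = Some m].
have ex_code p : exists c, codes p c.
  case: p => p [t Dt pt]; have [u [ev [Du tu su evp]]] := spanned_restriction Dt.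
  have /choice[c cP] : forall w, exists o : option A, forall m,
      base_map u m = ev w <-> o = Some m.
    move=> w; have [[m em]|no] := pselect (exists m, base_map u m = ev w).
      exists (Some m) => m'; split=> [e|[<-] //].
      by congr Some; apply: (@base_map_inj _ _ _ _ u); rewrite em e.
    by exists None => m; split=> // e; case: no; exists m.
  exists c, u, ev; split=> //=; rewrite pt; exact: gtp_eq.
exists (fun p => projT1 (cid (ex_code p))) => p q.
case: (cid (ex_code p)) => c [u [eu [pu su eup cu]]] /=.
case: (cid (ex_code q)) => c' [v [ev [qv sv evp cv]]] /= e; subst c'.
have e : sval p = sval q.
  rewrite pu qv; apply: gtp_eq; apply: (same_trace_related su sv) => // w m.
  exact: iff_trans (cu w m) (iff_sym (cv w m)).
case: p q e {pu qv} => [p hp] [q hq] /= e; subst q.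
congr exist; exact: Prop_irrelevance.
Qed.

End Shape.
End Deconstructible.

(* [K], [Kp] and [L] are types of cardinality kappa, kappa^+ and lambda. *)
Theorem theorem3p18 (R : pzRingType) (K Kp L : Type)
  (D : rmodType R -> Prop) (M : morphism_class R)
  (hK : [set: (R + nat)%type] #<= [set: K])
  (hKp : is_succ_card K Kp)
  (hD : deconstructible Kp D)
  (hM : M = @embeddings R \/ M = @RD_embeddings R \/ M = @pure_embeddings R)
  (hL : infinite_card L)
  (hLK : [set: K -> L] #= [set: L]) :
  stable_in D M L.
Proof.
move=> A _ AL; have [shape MP] := morphism_class_shape hM.
have [code code_inj] := gS_code hKp hD MP A.
have inj_card (T U : Type) : [set: T] #<= [set: U] -> infinite_card U ->
    exists f : T -> U, injective f.
  elim/Ppointed: U => U; last first.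
    by move=> /pcard_injP[f finj] _; exists f; apply: in2TT finj.
  by rewrite /infinite_card empty_eq0 => _ [].
have hK_L : absorbs L K.
  by apply: inj_card => //; move: hLK; rewrite card_eq_le => /andP[].
have [g gsurj] := card_le_cover (inr 0%N) hK.
have absorbs_via (T : Type) (h : R + nat -> T) :
    (forall x, exists s, h s = x) -> absorbs L T.
  move=> hsurj; apply: (absorbs_surj (g := h \o g) _ hK_L) => x.
  by have [s <-] := hsurj x; have [k _ <-] := gsurj s Logic.I; exists k.
have hN : absorbs L nat.
  apply: (absorbs_via _ (fun s => if s is inr n then n else 0%N)) => n.
  by exists (inr n).
have hR : absorbs L R^c.
  apply: (absorbs_via _ (fun s => if s is inl a then a else 0)) => a.
  by exists (inl a).
have [f finj] := absorbs_term hN hR hK_L.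
have [e einj] : exists e : A -> L, injective e.
  by apply: inj_card => //; move: AL; rewrite card_eq_le => /andP[].
have [i iinj] : exists i : nat -> L, injective i.
  by apply: inj_card => //; exact/infiniteP.
have i01 : i 0%N <> i 1%N by move/iinj.
have [o oinj] := option_inj (absorbs_bool hN) i01.
exists (fun p => f (fun w => o (omap e (code p w)))) => p q /finj pq.
apply: code_inj; apply/funext => w.
have /oinj : o (omap e (code p w)) = o (omap e (code q w)) := congr1 (@^~ w) pq.
by case: (code p w) (code q w) => [x|] [y|] //= [/einj ->].
Qed.
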